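(* For any nonnegative integers $m_2<m_1$ and all $a,b>0$, if $p=-1$ then $M_{p,m_1,m_2}(a,b)=\dfrac{2ab}{a+b}$.
   Context: Let $m_2<m_1$ be nonnegative integers and $n=m_1+m_2+1$. For $f\in C^{n+2}(0,\infty)$ with $f^{(n+1)}$ nowhere zero and $0<a<b$, let $P,Q$ be the unique polynomials of degree at most $n$ with $P^{(j)}(a)=f^{(j)}(a)$ for $0\le j\le m_1$, $P^{(j)}(b)=f^{(j)}(b)$ for $0\le j\le m_2$, and $Q^{(j)}(a)=f^{(j)}(a)$ for $0\le j\le m_2$, $Q^{(j)}(b)=f^{(j)}(b)$ for $0\le j\le m_1$. The equation $f(x)-P(x)=(-1)^{m_1-m_2}\,(f(x)-Q(x))$ has exactly one solution $x\in(a,b)$, and this solution is denoted $M_{f,m_1,m_2}(a,b)$. One extends the definition by $M_{f,m_1,m_2}(b,a)=M_{f,m_1,m_2}(a,b)$ and $M_{f,m_1,m_2}(a,a)=a$. For real $p\notin\{0,1,\dots,n\}$, $M_{p,m_1,m_2}$ denotes $M_{f,m_1,m_2}$ with $f(x)=x^p$. *)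

(* Defs.v *)
From HB Require Import structures.
From mathcomp Require Import all_boot all_order all_algebra.
From mathcomp Require Import all_classical all_reals all_analysis.
Import Order.TTheory GRing.Theory Num.Theory numFieldNormedType.Exports.

Set Implicit Arguments.
Unset Strict Implicit.
Unset Printing Implicit Defensive.

Local Open Scope classical_set_scope.
Local Open Scope ring_scope.

(* Functions on (0, +oo) are represented by total functions R -> R; since
   derivatives are local and are only taken at positive points, the values
   outside (0, +oo) play no role. *)

(* "Degree at most k + l + 1" is a bound on [size], which is degree + 1. *)
Definition hermite_interpolant (R : realType) (f : R -> R) (k l : nat)
    (a b : R) : set {poly R} :=
  [set P : {poly R} |
    [/\ (size P <= (k + l + 1).+1)%N,
        forall j : nat, (j <= k)%N -> (derivn j P).[a] = derive1n j f a &
        forall j : nat, (j <= l)%N -> (derivn j P).[b] = derive1n j f b]].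

(* [xget] picks an element of the set; the default 0 is returned only if the
   set is empty. *)
Definition hermite_poly (R : realType) (f : R -> R) (k l : nat) (a b : R) :
    {poly R} :=
  xget 0 (hermite_interpolant f k l a b).

Definition mean_equation (R : realType) (f : R -> R) (m1 m2 : nat)
    (a b : R) : set R :=
  let P := hermite_poly f m1 m2 a b in
  let Q := hermite_poly f m2 m1 a b in
  [set x | a < x < b /\
           f x - P.[x] = (-1) ^+ (m1 - m2) * (f x - Q.[x])].

(* For 0 < a < b the default 0 lies outside ]a, b[, so it cannot be confused
   with a solution. *)
Definition hermite_mean (R : realType) (f : R -> R) (m1 m2 : nat)
    (a b : R) : R :=
  if a < b then xget 0 (mean_equation f m1 m2 a b)
  else if b < a then xget 0 (mean_equation f m1 m2 b a)
  else a.

Definition power_hermite_mean (R : realType) (p : R) (m1 m2 : nat)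
    (a b : R) : R :=
  hermite_mean (fun x : R => x `^ p) m1 m2 a b.

(* Main.v *)
Require Import Defs.
From mathcomp Require Import all_boot all_order all_algebra.
From mathcomp Require Import all_classical all_reals all_analysis.
From mathcomp Require Import ring lra zify.
Import Order.TTheory GRing.Theory Num.Theory numFieldNormedType.Exports.
Local Open Scope ring_scope.

(* Since [1 - x P(x) = x (1/x - P(x))], the polynomial [P] matches the jets of
   [1/x] at the nodes [a] and [b] iff [1 - x P] is a multiple of
   [W = (x - a)^(k+1) (x - b)^(l+1)]; by degree and evaluation at [0],
   [1/x - P(x) = W(x) / (x W(0))].  Dividing the equation of the mean by the
   common factors leaves [((x - a)/a)^d = ((b - x)/b)^d] with [d = m1 - m2],
   hence [(x - a)/a = (b - x)/b]. *)

(** Induction on [k], using that differentiation lowers the multiplicity of a root by exactly one.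
    If [p = q (x - a)^k] and [(x - a)^k] divides [p'], then [x - a] divides [k q], hence [q], by
    characteristic zero. *)
Lemma dvdp_exp_XsubC_derivn (F : numFieldType) (a : F) (k : nat)
    (p : {poly F}) :
  (('X - a%:P) ^+ k %| p) <-> (forall j, (j < k)%N -> p^`(j).[a] = 0).
Proof.
elim: k p => [|k IH] p; first by split=> // _; rewrite expr0 dvd1p.
split=> [/dvdpP[q ->] [_|j jk]|pa0].
- by rewrite derivn0 exprS !hornerM hornerXsubC subrr mul0r mulr0.
- rewrite derivSn (IH _).1 // derivM deriv_exp derivXsubC mul1r /=.
  by rewrite mulrnAr -mulrnAl exprS mulrA -mulrDl dvdp_mulIr.
- have /dvdpP[q pE] : ('X - a%:P) ^+ k %| p.
    by apply/IH => j jk; exact/pa0/ltnW.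
  have : ('X - a%:P) ^+ k %| p^`().
    by apply/IH => j jk; rewrite -derivSn pa0.
  rewrite pE exprS dvdp_mul2r ?expf_neq0 ?polyXsubC_eq0 // dvdp_XsubCl.
  (* For [k = 0] the derivative gives no information on [q]; there [q = p], and [p(a) = 0] is used
     directly. *)
  case: k {IH} pE pa0 => [|k] pE pa0.
    by rewrite /root -(pa0 0%N) // pE derivn0 mulr1.
  rewrite derivM dvdp_addr ?dvdp_mulIr // deriv_exp derivXsubC mul1r /=.
  rewrite mulrnAr -mulrnAl exprS.
  rewrite dvdp_mul2r ?expf_neq0 ?polyXsubC_eq0 // dvdp_XsubCl.
  by rewrite /root hornerMn mulrn_eq0.
Qed.

(** For [p = -1] this is the recurrence that the Leibniz rule yields for the jets of an interpolant.
    It is read off the closed form with a falling factorial. *)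
Lemma derive1nS_powR (R : realType) (p x : R) (j : nat) : 0 < x ->
  x * derive1n j.+1 (fun y => y `^ p) x
  = (p - j%:R) * derive1n j (fun y => y `^ p) x.
Proof.
have derivE i y : 0 < y -> derive1n i (fun z : R => z `^ p) y
    = (\prod_(k < i) (p - k%:R)) * y `^ (p - i%:R).
  elim: i y => [|i IH] y y0; first by rewrite big_ord0 mul1r subr0.
  rewrite derive1nS derive1E.
  (* The closed form is known only at positive points, so it is substituted under the derivative on
     a neighbourhood of [y]. *)
  have /near_eq_derive -> : \near y, derive1n i (fun z : R => z `^ p) y
      = (\prod_(k < i) (p - k%:R)) * y `^ (p - i%:R).
    near=> z; apply: IH; near: z; exact: lt_nbhsr.
  have dpow := is_derive1_powR (p - i%:R) y0.
  rewrite deriveZ//= (@derive_val _ _ _ _ _ _ _ dpow).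
  rewrite big_ord_recr /= -mulrA; congr (_ * (_ * _ `^ _)).
  by rewrite -natr1; ring.
move=> x0; rewrite !derivE// big_ord_recr /= -natr1 opprD addrA.
rewrite [_ `^ (_ - 1)]powRB ?(gt_eqF x0) ?implybT // powRr1 ?ltW //.
by field; rewrite gt_eqF.
Unshelve. all: by end_near. Qed.

(** By Leibniz, [(x P - 1)^(j+1)(a) = (j+1) P^(j)(a) + a P^(j+1)(a)], and the same expression with
    [1/x] in place of [P] is zero. As [a] is nonzero, the jets agree, order by order, exactly when
    these derivatives vanish. *)
Lemma jet_powRN1P (R : realType) (a : R) (k : nat) (P : {poly R}) : 0 < a ->
  (forall j, (j <= k)%N -> P^`(j).[a] = derive1n j (fun x => x `^ (-1)) a)
  <-> ('X - a%:P) ^+ k.+1 %| P * 'X - 1.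
Proof.
move=> a0; set f := fun x => _.
have f0 : derive1n 0 f a = a^-1 by rewrite /f /= powR_inv1 // ltW.
have fS j : a * derive1n j.+1 f a = - (j.+1%:R * derive1n j f a).
  by rewrite derive1nS_powR // -natr1; ring.
have S0 : (P * 'X - 1)^`(0).[a] = P.[a] * a - 1.
  by rewrite derivn0 !hornerE.
have SS j : (P * 'X - 1)^`(j.+1).[a] = j.+1%:R * P^`(j).[a] + a * P^`(j.+1).[a].
  rewrite -polyC1 -polyCN derivnMXaddC hornerD hornerMn hornerMX.
  by rewrite -mulr_natl [a * _]mulrC.
rewrite dvdp_exp_XsubC_derivn; split=> [Pf [_|j jk]|Sa].
- by rewrite S0 -[P]/(P^`(0)) Pf // f0 mulVf ?subrr ?gt_eqF.
- by rewrite SS !Pf // 1?ltnW // fS subrr.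
- elim=> [_|j IH jk].
    move: (Sa 0%N isT); rewrite S0 f0 derivn0 => /subr0_eq Pa.
    by rewrite -[LHS](mulfK (lt0r_neq0 a0)) Pa mul1r.
  apply: (mulfI (lt0r_neq0 a0)); rewrite fS -IH 1?ltnW //.
  by apply/eqP; rewrite -addr_eq0 addrC -SS Sa.
Qed.

Definition nodal_poly {R : nzRingType} (k l : nat) (a b : R) : {poly R} :=
  ('X - a%:P) ^+ k.+1 * ('X - b%:P) ^+ l.+1.

Lemma horner_nodal_poly (R : comNzRingType) (k l : nat) (a b x : R) :
  (nodal_poly k l a b).[x] = (x - a) ^+ k.+1 * (x - b) ^+ l.+1.
Proof. by rewrite hornerM !horner_exp !hornerXsubC. Qed.

Lemma nodal_poly0_neq0 (R : idomainType) (k l : nat) (a b : R) :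
  a != 0 -> b != 0 -> (nodal_poly k l a b).[0] != 0.
Proof.
move=> a0 b0; rewrite horner_nodal_poly !sub0r.
by rewrite mulf_neq0 // expf_neq0 // oppr_eq0.
Qed.

Lemma hermite_interpolant_powRN1P (R : realType) (k l : nat) (a b : R)
    (P : {poly R}) : 0 < a -> 0 < b -> a != b ->
  hermite_interpolant (fun x => x `^ (-1)) k l a b P <->
  P * 'X = 1 - (nodal_poly k l a b).[0]^-1 *: nodal_poly k l a b.
Proof.
move=> a0 b0 ab; set W := nodal_poly _ _ _ _.
have sW : size W = (k + l + 1).+2.
  rewrite /W size_Mmonic ?monic_exp ?monicXsubC //; last first.
    by rewrite expf_neq0 // polyXsubC_eq0.
  by rewrite !size_exp_XsubC; lia.
have W0 : W.[0] != 0 by rewrite nodal_poly0_neq0 // lt0r_neq0.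
split=> [[sP /(jet_powRN1P _ _ _ _ a0) da /(jet_powRN1P _ _ _ _ b0) db]|PE].
- have /dvdpP[q qE] : W %| P * 'X - 1.
    by rewrite Gauss_dvdp ?da // coprimep_expl // coprimep_expr //
      coprimep_XsubC root_XsubC eq_sym.
  (* Both [W] and the bound on [x P - 1] have degree [k + l + 2], so the quotient is a constant; its
     value comes from [x = 0], where [x P - 1] is [-1]. *)
  have : (size q <= 1)%N.
    have [->|q0] := eqVneq q 0; first by rewrite size_poly0.
    have Wn0 : W != 0 by rewrite -size_poly_gt0 sW.
    have : (size (P * 'X - 1)%R <= (k + l + 1).+2)%N.
      rewrite (leq_trans (size_polyD _ _)) // geq_max size_polyN size_poly1.
      by rewrite (leq_trans (size_polyMleq _ _)) // size_polyX; lia.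
    by rewrite qE size_mul // sW addnS /= addnS ltnS -[leqRHS]add1n leq_add2r.
  move=> /size1_polyC; set c := q`_0 => qc.
  have cW : c * W.[0] = -1.
    move: (congr1 (fun p => p.[0]) qE).
    by rewrite qc hornerD hornerMX hornerN hornerM !hornerC mulr0 sub0r => /esym.
  have -> : W.[0]^-1 = - c.
    by apply: (mulIf W0); rewrite mulVf // mulNr cW opprK.
  by rewrite scaleNr opprK -mul_polyC -qc -qE addrC subrK.
have SE : P * 'X - 1 = - W.[0]^-1 *: W by rewrite PE addrC addKr scaleNr.
split.
- have [->|Pn0] := eqVneq P 0; first by rewrite size_poly0.
  rewrite -ltnS -(size_mulX Pn0) PE (leq_trans (size_polyD _ _)) //.
  by rewrite geq_max size_poly1 size_polyN -sW size_scale_leq sW.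
- by apply/jet_powRN1P => //; rewrite SE dvdpZr ?oppr_eq0 ?invr_eq0 // dvdp_mulr.
- by apply/jet_powRN1P => //; rewrite SE dvdpZr ?oppr_eq0 ?invr_eq0 // dvdp_mull.
Qed.

Lemma sub_hermite_poly_powRN1 (R : realType) (k l : nat) (a b x : R) :
  0 < a -> 0 < b -> a != b -> 0 < x ->
  x `^ (-1) - (hermite_poly (fun y => y `^ (-1)) k l a b).[x]
  = (1 - x / a) ^+ k.+1 * (1 - x / b) ^+ l.+1 / x.
Proof.
move=> a0 b0 ab x0; pose W := nodal_poly k l a b.
(* The right-hand side vanishes at [0], so [x] divides it. This makes the set of interpolants
   nonempty, and [xget] returns a member rather than its default. *)
have [P PE] : exists P, P * 'X = 1 - W.[0]^-1 *: W.
  have : root (1 - W.[0]^-1 *: W) 0.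
    by rewrite /root hornerD hornerN hornerZ hornerC mulVf ?subrr //
      nodal_poly0_neq0 // lt0r_neq0.
  by move=> /factor_theorem[P]; rewrite subr0 => ?; exists P.
have := xgetI 0 ((hermite_interpolant_powRN1P _ _ _ _ _ P a0 b0 ab).2 PE).
move=> /(hermite_interpolant_powRN1P _ _ _ _ _ _ a0 b0 ab).
move=> /(congr1 (fun p => p.[x])); rewrite -/W hornerMX hornerD hornerN.
rewrite hornerZ hornerC => HE.
apply: (mulIf (lt0r_neq0 x0)); rewrite powR_inv1 ?ltW // mulrBl HE.
rewrite mulVf ?divfK ?lt0r_neq0 // opprB addrC subrK.
have ratioE (c : R) (n : nat) : 0 < c ->
    (x - c) ^+ n / (0 - c) ^+ n = (1 - x / c) ^+ n.
  by move=> c0; rewrite -expr_div_n; congr (_ ^+ n); field; rewrite lt0r_neq0.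
by rewrite mulrC !horner_nodal_poly -mulf_div !ratioE.
Qed.

Lemma hermite_mean_powRN1 (R : realType) (m1 m2 : nat) (a b : R) :
  (m2 < m1)%N -> 0 < a -> a < b ->
  xget 0 (mean_equation (fun x => x `^ (-1)) m1 m2 a b) = 2 * a * b / (a + b).
Proof.
move=> hm a0 ab; have b0 := lt_trans a0 ab.
have ab0 : 0 < a + b by rewrite addr_gt0.
have meanE x : a < x < b ->
    mean_equation (fun x => x `^ (-1)) m1 m2 a b x <-> x = 2 * a * b / (a + b).
  move=> /andP[ax xb]; have x0 := lt_trans a0 ax.
  have s0 : 0 < x / a - 1 by rewrite subr_gt0 ltr_pdivlMr // mul1r.
  have t0 : 0 < 1 - x / b by rewrite subr_gt0 ltr_pdivrMr // mul1r.
  have d0 : (0 < m1 - m2)%N by rewrite subn_gt0.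
  have m1E : m1.+1 = (m1 - m2 + m2.+1)%N by rewrite addnS subnK // ltnW.
  rewrite /mean_equation /= !sub_hermite_poly_powRN1 ?lt_eqF // ax xb.
  rewrite -[1 - x / a]opprB m1E; set s := x / a - 1; set t := 1 - x / b.
  set d := (m1 - m2)%N.
  transitivity (s ^+ d = t ^+ d).
    rewrite !exprD (exprNn s d).
    (* This is the factor common to both sides: the sign [(-1)^d] on the left comes out of
       [(- s)^d], on the right it is the one in the equation. *)
    have st0 : (-1) ^+ d * (- s) ^+ m2.+1 * t ^+ m2.+1 / x != 0.
      by rewrite !mulf_neq0 ?signr_eq0 ?expf_neq0 ?invr_neq0 ?oppr_eq0 ?lt0r_neq0.
    split=> [[_ E]|E].
      by apply: (mulfI st0); move: E; rewrite !mulrA; lra.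
    split=> //; rewrite E; ring.
  transitivity (s = t).
    (* Powers with exponent [d > 0] are injective on nonnegative reals. *)
    split=> [/eqP|-> //]; rewrite eqrXn2 ?ltW //; exact/eqP.
  rewrite /s /t; split=> [E|->]; last by field; rewrite !lt0r_neq0.
  have : (x / a - 1 - (1 - x / b)) * (a * b) = x * (a + b) - 2 * a * b.
    by field; rewrite !lt0r_neq0.
  by rewrite E subrr mul0r => /esym/subr0_eq <-; rewrite mulfK // lt0r_neq0.
(* The harmonic mean is a solution, since [a (a + b) < 2 a b < b (a + b)] puts it in the interval,
   and every solution equals it. *)
apply: xget_unique => [|y My].
  by apply/meanE => //; rewrite ltr_pdivlMr // ltr_pdivrMr //; nra.
by apply/meanE => //; case: My.
Qed.

Theorem theorem7 (R : realType) (m1 m2 : nat) (hm : (m2 < m1)%N)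
  (a b p : R) (ha : 0 < a) (hb : 0 < b) (hp : p = -1) :
  power_hermite_mean p m1 m2 a b = 2 * a * b / (a + b).
Proof.
rewrite hp /power_hermite_mean /hermite_mean.
case: ltgtP => [ab|ba|->].
- exact: hermite_mean_powRN1.
- by rewrite hermite_mean_powRN1 // [b + a]addrC [2 * b * a]mulrAC.
- by field; lra.
Qed.
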